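(* Let $G$ be a finite abelian group and let $\mathcal A$ be an S-ring over $G$ such that $\mathcal A=\mathcal A_U\wr_S\mathcal A_{G/L}$ for some $\mathcal A$-section $S=U/L$. If the groups $\mathrm{Aut}(\mathcal A_U)^S\cap\mathrm{Aut}(\mathcal A_{G/L})^S$ and $\mathrm{Aut}(\mathcal A_S)$ are not $2$-equivalent, then the S-ring $\mathcal A$ is non-schurian.
   Context: For a finite group $G$, an S-ring over $G$ is a subring $\mathcal A$ of $\mathbb Z G$ with a $\mathbb Z$-basis $\{\sum_{x\in X}x: X\in\mathcal S(\mathcal A)\}$, where $\mathcal S(\mathcal A)$ is a partition of $G$ with $\{1\}\in\mathcal S(\mathcal A)$ and $X^{-1}\in\mathcal S(\mathcal A)$ for all $X\in\mathcal S(\mathcal A)$; the classes $X$ are the basic sets. An $\mathcal A$-subgroup is a subgroup of $G$ that is a union of basic sets; an $\mathcal A$-section is a quotient $U/L$ of $\mathcal A$-subgroups $L\trianglelefteq U$. $\mathcal A_{U/L}$ is the S-ring over $U/L$ whose basic sets are the images in $U/L$ of the basic sets contained in $U$ ($\mathcal A_U$ when $L=1$). $\mathrm{Aut}(\mathcal A)$ is the group of all $f\in\mathrm{Sym}(G)$ preserving each relation $R_X=\{(g,xg):g\in G,x\in X\}$, $X\in\mathcal S(\mathcal A)$. $\mathcal A$ is schurian if there is $\Gamma\le\mathrm{Sym}(G)$ whose orbits on $G\times G$ are exactly the relations $R_X$. $\mathcal A=\mathcal A_U\wr_{U/L}\mathcal A_{G/L}$ (generalized wreath product) means that $L$ is normal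 in $G$ and $LX=XL=X$ for every basic set $X\subset G\setminus U$ (the cases $L=1$ or $U=G$ are allowed). For $S=U/L$: $\mathrm{Aut}(\mathcal A_U)^S$ is the permutation group induced by $\mathrm{Aut}(\mathcal A_U)$ on the set $U/L$ of $L$-cosets in $U$, and $\mathrm{Aut}(\mathcal A_{G/L})^S$ is the permutation group induced on the subset $U/L$ of $G/L$ by its setwise stabilizer in $\mathrm{Aut}(\mathcal A_{G/L})$. Two subgroups of $\mathrm{Sym}(V)$ are $2$-equivalent if they have the same orbits in the coordinatewise action on $V^2$. *)

(* Defs.v *)
From HB Require Import structures.
From mathcomp Require Import all_boot all_order all_fingroup all_algebra.

Set Implicit Arguments.
Unset Strict Implicit.
Unset Printing Implicit Defensive.

Import GroupScope.

(* The integral group ring is carried by {ffun gT -> int}, whose library ring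
   product is pointwise; the group ring product is the convolution below.
   The group ring of a subgroup G consists of the functions supported in G. *)
Definition gring_mul (gT : finGroupType) (a b : {ffun gT -> int}) :
    {ffun gT -> int} :=
  [ffun g => (\sum_(h : gT) a h * b (h^-1 * g)%g)%R].

(* The formal sum of the elements of X. *)
Definition gring_sum (gT : finGroupType) (X : {set gT}) : {ffun gT -> int} :=
  [ffun g => ((g \in X)%:R)%R].

Definition gring_comb (gT : finGroupType) (S : {set {set gT}})
    (c : {set gT} -> int) : {ffun gT -> int} :=
  (\sum_(X in S) gring_sum X *~ c X)%R.

Definition gring_subring (gT : finGroupType) (A : {ffun gT -> int} -> Prop) :
    Prop :=
  [/\ A (gring_sum [set 1]),
      forall a b, A a -> A b -> A (a - b)%R
    & forall a b, A a -> A b -> A (gring_mul a b)].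

Definition gring_basis (gT : finGroupType) (A : {ffun gT -> int} -> Prop)
    (S : {set {set gT}}) : Prop :=
  (forall a, A a <-> exists c : {set gT} -> int, a = gring_comb S c) /\
  (forall c : {set gT} -> int,
     gring_comb S c = 0%R -> forall X, X \in S -> c X = 0%R).

Record sring (gT : finGroupType) (G : {group gT}) := SRing {
  sring_mem : {ffun gT -> int} -> Prop;
  basic_sets : {set {set gT}};
  sring_subring : gring_subring sring_mem;
  basic_partition : partition basic_sets G;
  basic_set1 : [set 1] \in basic_sets;
  basic_inv : forall X : {set gT}, X \in basic_sets -> X^-1 \in basic_sets;
  sring_basis : gring_basis sring_mem basic_sets
}.

(* The notions below depend on an S-ring only through its basic sets, so they
   take the family S of basic sets as argument. *)

Definition is_Asubgroup (gT : finGroupType) (S : {set {set gT}})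
    (H : {group gT}) : Prop :=
  exists2 P : {set {set gT}}, P \subset S & cover P = H.

Definition is_Asection (gT : finGroupType) (S : {set {set gT}})
    (U L : {group gT}) : Prop :=
  [/\ is_Asubgroup S U, is_Asubgroup S L & L <| U].

Definition sub_basic (gT : finGroupType) (S : {set {set gT}})
    (U : {set gT}) : {set {set gT}} :=
  [set X in S | X \subset U].

Definition sec_basic (gT : finGroupType) (S : {set {set gT}})
    (U L : {set gT}) : {set {set coset_of L}} :=
  [set X / L | X in sub_basic S U].

Definition gen_wreath (gT : finGroupType) (G : {group gT})
    (S : {set {set gT}}) (U L : {group gT}) : Prop :=
  L <| G /\
  forall X : {set gT}, X \in S -> X \subset G :\: U ->
    L * X = X /\ X * L = X.

Definition pair_act (T : finType) (p : T * T) (f : {perm T}) : T * T :=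
  (f p.1, f p.2).

Lemma pair_act1 (T : finType) : (@pair_act T)^~ 1 =1 id.
Proof. by case=> x y; rewrite /pair_act !perm1. Qed.

Lemma pair_actM (T : finType) (p : T * T) : act_morph (@pair_act T) p.
Proof. by move=> f h; rewrite /pair_act !permM. Qed.

Canonical pair_action (T : finType) :=
  TotalAction (@pair_act1 T) (@pair_actM T).

(* The orbits on V x V of a group of permutations of V. Permutations of a
   subset V of T are represented by the elements of {perm T} fixing every
   point outside V. *)
Definition orbits2 (T : finType) (V : {set T}) (F : {set {perm T}}) :
    {set {set T * T}} :=
  orbit (pair_action T) F @: setX V V.

Definition two_equiv (T : finType) (V : {set T}) (F H : {group {perm T}}) :
    Prop :=
  orbits2 V F = orbits2 V H.

Definition basic_rel (gT : finGroupType) (G X : {set gT}) : {set gT * gT} :=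
  [set (g, x * g) | g in G, x in X].

Definition sring_aut (gT : finGroupType) (G : {set gT}) (S : {set {set gT}}) :
    {set {perm gT}} :=
  Sym G :&: \bigcap_(X in S) 'N(basic_rel G X | pair_action gT).

Canonical sring_aut_group (gT : finGroupType) (G : {set gT})
    (S : {set {set gT}}) :=
  Eval hnf in [group of sring_aut G S].

Definition schurian (gT : finGroupType) (G : {set gT}) (S : {set {set gT}}) :
    Prop :=
  exists2 F : {group {perm gT}},
    F \subset Sym G & orbits2 G F = basic_rel G @: S.

(* The group induced by Aut(A_U) on the set U / L of L-cosets in U. *)
Definition aut_U_sec (gT : finGroupType) (S : {set {set gT}})
    (U L : {group gT}) : {set {perm coset_of L}} :=
  [set s in Sym (U / L) | [exists f in sring_aut U (sub_basic S U),
     [forall x in U, s (coset L x) == coset L (f x)]]].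

Lemma aut_U_sec_group_set (gT : finGroupType) (S : {set {set gT}})
    (U L : {group gT}) : group_set (aut_U_sec S U L).
Proof.
apply/group_setP; split=> [|s t].
  rewrite inE group1; apply/existsP; exists 1; rewrite group1.
  by apply/forall_inP=> x _; rewrite !perm1.
rewrite !inE => /andP[Ss /exists_inP[f Af /forall_inP sf]].
move=> /andP[St /exists_inP[h Ah /forall_inP th]].
have ->: perm_on (U / L) (s * t) by apply: perm_onM.
apply/exists_inP; exists (f * h); first by rewrite groupM.
apply/forall_inP=> x Ux; rewrite !permM (eqP (sf x Ux)) (eqP (th _ _)) //.
by move: Af; rewrite !inE => /andP[Uf _]; rewrite (perm_closed _ Uf).
Qed.

Canonical aut_U_sec_group (gT : finGroupType) (S : {set {set gT}})
    (U L : {group gT}) :=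
  Group (aut_U_sec_group_set S U L).

(* The group induced on U / L by its setwise stabilizer in Aut(A_(G/L)). *)
Definition aut_quo_sec (gT : finGroupType) (G : {group gT})
    (S : {set {set gT}}) (U L : {group gT}) : {set {perm coset_of L}} :=
  restr_perm (U / L) @* 'N_(sring_aut (G / L) (sec_basic S G L))(U / L | 'P).

Canonical aut_quo_sec_group (gT : finGroupType) (G : {group gT})
    (S : {set {set gT}}) (U L : {group gT}) :=
  Eval hnf in [group of aut_quo_sec G S U L].

(* Main.v *)
(** If a group [F] realises the S-ring, the stabiliser of [U] in [F] permutes
    the [L]-cosets contained in [U]; the induced group [D] on [U / L] lies in
    both [Aut(A_U)^S] and [Aut(A_(G/L))^S]. Since [F] is transitive on each
    relation [R_X] with [X] inside [U], [D] is transitive on each relation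
    [R_(X/L)]. As [Aut(A_U)^S] lies in [Aut(A_S)], which preserves these
    relations, every group between [D] and [Aut(A_S)] has the relations
    [R_(X/L)] as its orbits on pairs. *)
Require Import Defs.
From mathcomp Require Import all_boot all_order all_fingroup all_algebra.

Set Implicit Arguments.
Unset Strict Implicit.
Unset Printing Implicit Defensive.

Import GroupScope.

Lemma mem_basic_rel (gT : finGroupType) (G X : {set gT}) (x y : gT) :
  ((x, y) \in basic_rel G X) = (x \in G) && (y * x^-1 \in X).
Proof.
apply/imset2P/andP=> [[g z Gg Xz [-> ->]]|[Gx Xyx]]; first by rewrite mulgK.
by exists x (y * x^-1); rewrite ?mulgKV.
Qed.

(** An implication suffices: a permutation mapping a finite relation into itself maps it onto
    itself. *)
Lemma sring_autP (gT : finGroupType) (G : {set gT}) (S : {set {set gT}})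
    (f : {perm gT}) :
  reflect (perm_on G f /\
           forall X x y, X \in S -> x \in G -> y * x^-1 \in X ->
             f y * (f x)^-1 \in X)
    (f \in sring_aut G S).
Proof.
rewrite 2!inE; apply: (iffP andP) => -[Gf fS]; split=> //.
  move=> X x y SX Gx Xyx; move/bigcapP: fS => /(_ X SX) fX.
  have: pair_act (x, y) f \in basic_rel G X.
    by rewrite (astabs_act (x, y) fX) mem_basic_rel Gx.
  by rewrite mem_basic_rel => /andP[].
apply/bigcapP=> X SX; rewrite inE in_setT inE; apply/subsetP=> -[x y].
rewrite mem_basic_rel => /andP[Gx Xyx].
by rewrite inE mem_basic_rel /= (perm_closed _ Gf) Gx (fS X).
Qed.

(** The relation of lying in one right coset of [H] is a union of basic relations, so the right
    cosets of [H] in [G] are blocks for [f]. *)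
Lemma sring_aut_Asubgroup (gT : finGroupType) (G : {set gT})
    (S : {set {set gT}}) (H : {group gT}) (f : {perm gT}) (x y : gT) :
  is_Asubgroup S H -> f \in sring_aut G S -> x \in G -> y * x^-1 \in H ->
  f y * (f x)^-1 \in H.
Proof.
case=> P /subsetP sPS <- /sring_autP[_ fS] Gx /bigcupP[X PX Xyx].
by apply/bigcupP; exists X => //; apply: fS => //; apply: sPS.
Qed.

Lemma schurian_sring_aut (gT : finGroupType) (G : {set gT})
    (S : {set {set gT}}) (F : {group {perm gT}}) :
  F \subset Sym G -> orbits2 G F = basic_rel G @: S -> F \subset sring_aut G S.
Proof.
move=> sFG FS; rewrite subsetI sFG; apply/bigcapsP=> X SX.
have: basic_rel G X \in orbits2 G F by rewrite FS imset_f.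
by case/imsetP=> p _ ->; apply: acts_orbit; apply: subsetT.
Qed.

Lemma schurian_trans (gT : finGroupType) (G X : {set gT})
    (S : {set {set gT}}) (F : {group {perm gT}}) (p q : gT * gT) :
  orbits2 G F = basic_rel G @: S -> X \in S ->
  p \in basic_rel G X -> q \in basic_rel G X ->
  exists2 f, f \in F & pair_act p f = q.
Proof.
move=> FS SX; have: basic_rel G X \in orbits2 G F by rewrite FS imset_f.
case/imsetP=> r _ -> /orbit_eqP <-.
by case/orbitP=> f Ff <-; exists f.
Qed.

Lemma restr_sring_aut (gT : finGroupType) (G : {set gT}) (S : {set {set gT}})
    (U : {group gT}) (f : {perm gT}) :
  U \subset G -> f \in 'N(U | 'P) -> f \in sring_aut G S ->
  restr_perm U f \in sring_aut U (sub_basic S U).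
Proof.
move=> /subsetP sUG nUf /sring_autP[_ fS].
apply/sring_autP; split=> [|X x y]; first exact: restr_perm_on.
rewrite inE => /andP[SX /subsetP sXU] Ux Xyx.
have Uy: y \in U by rewrite -(groupMr _ (groupVr Ux)) sXU.
by rewrite !restr_permE ?fS ?sUG.
Qed.

Section QuotientPerm.

Variables (gT : finGroupType) (G L : {group gT}) (S : {set {set gT}}).
Hypotheses (nLG : L <| G) (AL : is_Asubgroup S L).

Lemma eq_coset (x y : gT) :
  x \in G -> y \in G -> (coset L x == coset L y) = (y * x^-1 \in L).
Proof.
move=> Gx Gy; have [_ /subsetP nL] := andP nLG.
rewrite eq_sym; apply/eqP/idP=> [Exy|Lyx].
  rewrite coset_idr ?groupM ?groupV ?nL //.
  by rewrite morphM ?morphV ?groupV ?nL //= Exy mulgV.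
by apply/rcoset_kercosetP; rewrite ?nL ?mem_rcoset.
Qed.

(** Since [L] is an A-subgroup, [f] permutes the [L]-cosets in [G] and so descends to [G / L]. *)
Lemma quotient_perm_exists (f : {perm gT}) :
  f \in sring_aut G S ->
  exists2 t, t \in sring_aut (G / L) (sec_basic S G L)
           & {in G, forall x, t (coset L x) = coset L (f x)}.
Proof.
move=> Af; have [Gf fS] := sring_autP _ _ _ Af.
have fG x : (f x \in G) = (x \in G) by rewrite (perm_closed _ Gf).
(* Preservation of cosets by the inverse will make the induced map injective. *)
have AfV: f^-1 \in sring_aut G S by rewrite groupV.
have fL x y : x \in G -> y \in G ->
    (coset L (f x) == coset L (f y)) = (coset L x == coset L y).
  move=> Gx Gy; rewrite !eq_coset ?fG //; apply/idP/idP.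
    move/(sring_aut_Asubgroup AL AfV); rewrite fG => /(_ Gx).
    by rewrite !permK.
  exact: sring_aut_Asubgroup AL Af Gx.
(* Apply [f] to a chosen representative of [u]. The type [coset_of L] covers all of ['N(L) / L], so
   [q] is the identity off [G / L]. *)
pose q (u : coset_of L) :=
  if u \in G / L then coset L (f (odflt 1 [pick x in G | coset L x == u]))
  else u.
have qE x : x \in G -> q (coset L x) = coset L (f x).
  move=> Gx; rewrite /q mem_quotient //; case: pickP => [y|/(_ x)] /=.
    by case/andP=> Gy Exy; apply/eqP; rewrite fL.
  by rewrite Gx eqxx.
have qG u : (q u \in G / L) = (u \in G / L).
  have [/morphimP[x _ Gx ->]|/negPf GLu] := boolP (u \in G / L); last first.
    by rewrite /q GLu.
  by rewrite [coset_morphism _ _]/(coset L x) qE // mem_quotient ?fG.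
have q_inj : injective q.
  move=> u v Euv; have := qG v; rewrite -Euv qG.
  have [/morphimP[x _ Gx Du] /esym|/negPf Gu /esym Gv] := boolP (u \in G / L).
    case/morphimP=> y _ Gy Dv; apply/eqP; move/eqP: Euv.
    by rewrite Du Dv !qE // fL.
  by move: Euv; rewrite /q Gu Gv.
exists (perm q_inj) => [|x Gx]; last by rewrite permE qE.
apply/sring_autP; split.
  apply/subsetP=> u; rewrite inE permE; apply: contraR => /negPf Gu.
  by rewrite /q Gu.
move=> Z u v /imsetP[X]; rewrite inE => /andP[SX sXG] ->{Z}.
case/morphimP=> x Nx Gx ->{u} /morphimP[z Nz Xz Dv].
have Gz := subsetP sXG z Xz.
(* Replacing the representative of [v] by [z * x] lifts [(u, v)] to a pair in the basic relation of
   [X], which [f] preserves. *)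
have{Dv} ->: v = coset L (z * x) by rewrite morphM //= -Dv mulgKV.
have [_ /subsetP nL] := andP nLG.
rewrite !permE !qE ?groupM // -morphV -?morphM ?groupV ?nL ?fG ?groupM //.
apply: mem_morphim; first by rewrite ?nL ?groupM ?groupV ?fG ?groupM.
by apply: fS; rewrite ?mulgK.
Qed.

End QuotientPerm.

Section SectionGroup.

Variables (gT : finGroupType) (G U L : {group gT}) (S : {set {set gT}}).
Hypotheses (sSG : {in S, forall X : {set gT}, X \subset G}).
Hypotheses (nLG : L <| G) (AS : is_Asection S U L).

Lemma Asubgroup_sub (H : {group gT}) : is_Asubgroup S H -> H \subset G.
Proof.
by case=> P /subsetP sPS <-; apply/bigcupsP=> X /sPS; apply: sSG.
Qed.

(** [U] is itself one of the blocks, so a single point of [U] sent into [U] forces [f] to stabilise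
    it. *)
Lemma sring_aut_stab (f : {perm gT}) (x : gT) :
  f \in sring_aut G S -> x \in U -> f x \in U -> f \in 'N(U | 'P).
Proof.
case: AS => AU _ _ Af Ux Ufx; rewrite inE in_setT inE; apply/subsetP=> y Uy.
have /subsetP sUG := Asubgroup_sub AU.
rewrite inE /= /aperm -(groupMr _ (groupVr Ufx)).
by rewrite (sring_aut_Asubgroup AU Af) ?sUG // groupM ?groupV.
Qed.

(** One permutation of [U / L] serves both groups: it is induced by the restriction of [f] to [U],
    and it is the restriction to [U / L] of the permutation that [f] induces on [G / L]. *)
Lemma induced_section_perm (f : {perm gT}) :
  f \in sring_aut G S -> f \in 'N(U | 'P) ->
  exists2 s, s \in aut_U_sec_group S U L :&: aut_quo_sec_group G S U L
           & {in U, forall x, s (coset L x) = coset L (f x)}.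
Proof.
case: AS => AU AL nLU Af nUf; have sUG := Asubgroup_sub AU.
have [t At tE] := quotient_perm_exists nLG AL Af.
have fU x : x \in U -> f x \in U.
  by move=> Ux; have:= astabs_act x nUf; rewrite Ux.
have tN : t \in 'N(U / L | 'P).
  rewrite inE in_setT inE; apply/subsetP=> _ /morphimP[x _ Ux ->].
  by rewrite inE /= /aperm tE ?(subsetP sUG) // mem_quotient ?fU.
have sE : {in U, forall x, restr_perm (U / L) t (coset L x) = coset L (f x)}.
  by move=> x Ux; rewrite restr_permE ?mem_quotient // tE ?(subsetP sUG).
exists (restr_perm (U / L) t) => //; rewrite inE; apply/andP; split.
  rewrite 2!inE restr_perm_on; apply/exists_inP; exists (restr_perm U f).
    exact: restr_sring_aut Af.
  by apply/forall_inP=> x Ux; rewrite sE // restr_permE.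
by apply: mem_morphim => //; rewrite inE At.
Qed.

Lemma aut_U_sec_sub :
  aut_U_sec S U L \subset sring_aut (U / L) (sec_basic S U L).
Proof.
case: AS => _ _ /andP[_ /subsetP nL].
apply/subsetP=> s; rewrite 2!inE => /andP[sUL].
case/exists_inP=> f /sring_autP[Uf fS] /forall_inP sE.
apply/sring_autP; split=> // Z u v /imsetP[X SX ->{Z}].
case/morphimP=> x Nx Ux ->{u} /morphimP[z Nz Xz Dv].
have Uz: z \in U by move: SX; rewrite inE => /andP[_ /subsetP->].
have{Dv} ->: v = coset L (z * x) by rewrite morphM //= -Dv mulgKV.
rewrite (eqP (sE _ Ux)) (eqP (sE _ (groupM Uz Ux))).
have fU y : (f y \in U) = (y \in U) by rewrite (perm_closed _ Uf).
rewrite -morphV -?morphM ?groupV ?nL ?fU ?groupM //.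
apply: mem_morphim; first by rewrite ?nL ?groupM ?groupV ?fU ?groupM.
by apply: fS; rewrite ?mulgK.
Qed.

End SectionGroup.

Theorem corollary5p8 (gT : finGroupType) (G : {group gT}) (A : sring G)
    (U L : {group gT}) :
  abelian G ->
  is_Asection (basic_sets A) U L ->
  gen_wreath G (basic_sets A) U L ->
  ~ two_equiv (U / L)
      (aut_U_sec_group (basic_sets A) U L :&:
         aut_quo_sec_group G (basic_sets A) U L)%G
      (sring_aut_group (U / L) (sec_basic (basic_sets A) U L)) ->
  ~ schurian G (basic_sets A).
Proof.
move=> _ AS [nLG _] not_equiv [F sFG FS]; apply: not_equiv.
have [AU _ /andP[_ /subsetP nL]] := AS.
have sSG : {in basic_sets A, forall X : {set gT}, X \subset G}.
  move=> X SX; have /and3P[/eqP <- _ _] := basic_partition A.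
  exact: bigcup_sup.
have /subsetP sUG := Asubgroup_sub sSG AU.
have /subsetP sFA := schurian_sring_aut sFG FS.
have [P /subsetP sPS covP] := AU.
apply: eq_in_imset => -[_ _] /setXP[/morphimP[x _ Ux ->] /morphimP[y _ Uy ->]].
(* The orbits of the intersection are contained in those of the larger group [Aut(A_S)]; only the
   converse needs schurity. *)
apply/eqP; rewrite eqEsubset imsetS /=; last first.
  by apply: subset_trans (subsetIl _ _) _; apply: aut_U_sec_sub AS.
have: y * x^-1 \in cover P by rewrite covP groupM ?groupV.
case/bigcupP=> X PX Xyx; have SX := sPS X PX.
have sXU: X \subset U by rewrite -covP; apply: bigcup_sup.
(* Given [h] in [Aut(A_S)], an element of the intersection agreeing with [h] on this one pair is to
   be found. *)
apply/subsetP=> _ /orbitP[h /sring_autP[Uh hS] <-].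
have: h (coset L x) \in U / L by rewrite (perm_closed _ Uh) mem_quotient.
case/morphimP=> x' _ Ux' Dx'.
have: h (coset L y) * (h (coset L x))^-1 \in X / L.
  apply: hS; rewrite ?mem_quotient //.
    by apply: imset_f; rewrite inE SX.
  rewrite -morphV -?morphM ?groupV ?nL //.
  by apply: mem_morphim; rewrite ?nL ?groupM ?groupV.
(* The image pair lifts to [(x', z * x')], in the same basic relation as [(x, y)], so some [f] in
   [F] carries one lift to the other. *)
case/morphimP=> z Nz Xz Dz; have Uz := subsetP sXU z Xz.
have Dy': h (coset L y) = coset L (z * x').
  by rewrite morphM ?nL //= -Dz -[coset L x']Dx' mulgKV.
have [||f Ff [fx fy]] := @schurian_trans _ G X _ F (x, y) (x', z * x') FS SX.
- by rewrite mem_basic_rel sUG.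
- by rewrite mem_basic_rel sUG ?mulgK.
have nUf : f \in 'N(U | 'P).
  by apply: (sring_aut_stab sSG AS) (sFA f Ff) Ux _; rewrite fx.
have [s Ks sE] := induced_section_perm sSG nLG AS (sFA f Ff) nUf.
apply/orbitP; exists s => //=.
by rewrite /pair_act /= !sE // fx fy Dy' Dx'.
Qed.
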